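(* Let $G=(V,E)$ be a finite connected graph with $n$ vertices and maximal degree $\Delta$. Then $\mathcal{AC}(G) \leq 20\,\Delta\, n$.
   Context: Acquaintance time: Let $G=(V,E)$ be a finite connected graph. Initially one agent is placed on each vertex. At any moment, two agents located at the endpoints of a common edge become acquainted (in particular, agents on adjacent vertices at the start are acquainted). In each round one chooses a matching of $G$ (not necessarily maximal), and for every edge of the matching the two agents on its endpoints swap places; after each round, all pairs of agents on adjacent vertices become acquainted. A sequence of matchings after which every pair of agents has been acquainted is a strategy for acquaintance in $G$. The acquaintance time $\mathcal{AC}(G)$ is the minimal number of rounds in a strategy for acquaintance in $G$. *)

(* Defs.v *)
From mathcomp Require Import all_boot.
Set Implicit Arguments. Unset Strict Implicit. Unset Printing Implicit Defensive.

Definition simple_graph (T : finType) (e : rel T) : Prop :=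
  symmetric e /\ irreflexive e.

Definition connected_graph (T : finType) (e : rel T) : Prop :=
  forall x y : T, connect e x y.

Definition max_degree (T : finType) (e : rel T) : nat :=
  \max_(v : T) #|[set u | e v u]|.

(* A matching, encoded as an involution m of the vertices: each vertex is either
   unmatched (m v = v) or matched to the adjacent vertex m v. *)
Definition is_matching (T : finType) (e : rel T) (m : T -> T) : Prop :=
  forall v : T, m (m v) = v /\ (m v = v \/ e v (m v)).

(* Agents are named by their initial vertex. [position ms t a] is the vertex
   occupied by agent a after the first t rounds of the sequence of matchings ms
   (for each matched edge, the two agents swap places). *)
Fixpoint position (T : finType) (ms : seq (T -> T)) (t : nat) (a : T) : T :=
  match t with
  | 0 => a
  | t'.+1 => nth id ms t' (position ms t' a)
  end.

Definition acquaintance_strategy (T : finType) (e : rel T) (ms : seq (T -> T)) : Prop :=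
  (forall i, i < size ms -> is_matching e (nth id ms i)) /\
  forall a b : T, a != b ->
    exists t, t <= size ms /\ e (position ms t a) (position ms t b).

(* AC(G) <= k  iff some strategy uses at most k rounds (AC(G) is the minimum). *)
Definition AC_le (T : finType) (e : rel T) (k : nat) : Prop :=
  exists ms : seq (T -> T), acquaintance_strategy e ms /\ size ms <= k.

(* Main.v *)
Require Import Defs.
From mathcomp Require Import all_boot.
From mathcomp Require Import zify.

(** List the vertices along a tour of a spanning tree in which consecutive
    vertices are joined by paths with at most four vertices, every vertex lying on
    at most [Delta + 1] of these paths (this refines the classical fact that the
    cube of a connected graph has a Hamiltonian path). On a path of [n] vertices,
    [n] rounds of odd-even transposition make every two agents cross. Three
    matchings swap the ends of one of the short paths, making the two agents
    meet and restoring all the others; a family of short paths in which each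
    vertex lies on at most [Delta + 1] of them splits into [4 * Delta + 1]
    disjoint subfamilies, so one round of odd-even transposition costs
    [3 * (4 * Delta + 1) <= 20 * Delta] matchings. *)
Set Implicit Arguments. Unset Strict Implicit. Unset Printing Implicit Defensive.

Section Acquaintance.

Variables (T : finType) (e : rel T).
Implicit Types (ms : seq (T -> T)) (p : seq T) (l : seq (seq T)).

(** * Sequences of matchings and their concatenation *)

Definition all_matchings (ms : seq (T -> T)) : Prop :=
  forall i, i < size ms -> is_matching e (nth id ms i).

Definition final (ms : seq (T -> T)) (a : T) : T := position ms (size ms) a.

Definition meet (ms : seq (T -> T)) (a b : T) : Prop :=
  exists t, t <= size ms /\ e (position ms t a) (position ms t b).

Lemma all_matchings_cat ms1 ms2 :
  all_matchings ms1 -> all_matchings ms2 -> all_matchings (ms1 ++ ms2).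
Proof.
move=> h1 h2 i; rewrite size_cat nth_cat => ltis.
by case: ltnP => lti; [apply: h1 | apply: h2; lia].
Qed.

Lemma position_catl ms1 ms2 t a :
  t <= size ms1 -> position (ms1 ++ ms2) t a = position ms1 t a.
Proof. by elim: t => //= t IH lt; rewrite IH 1?ltnW // nth_cat lt. Qed.

Lemma position_catr ms1 ms2 t a :
  position (ms1 ++ ms2) (size ms1 + t) a = position ms2 t (final ms1 a).
Proof.
elim: t => [|t IH] /=; first by rewrite addn0 position_catl.
by rewrite addnS /= IH nth_cat ltnNge leq_addr /= addKn.
Qed.

Lemma final_cat ms1 ms2 a : final (ms1 ++ ms2) a = final ms2 (final ms1 a).
Proof. by rewrite {1}/final size_cat position_catr. Qed.

Lemma meet_catl ms1 ms2 a b : meet ms1 a b -> meet (ms1 ++ ms2) a b.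
Proof.
case=> t [let1 et]; exists t; rewrite size_cat !position_catl //.
by split=> //; apply: leq_trans let1 (leq_addr _ _).
Qed.

Lemma meet_catr ms1 ms2 a b :
  meet ms2 (final ms1 a) (final ms1 b) -> meet (ms1 ++ ms2) a b.
Proof.
case=> t [let1 et]; exists (size ms1 + t).
by rewrite size_cat leq_add2l !position_catr.
Qed.

Hypothesis e_sym : symmetric e.

Lemma meet_sym ms a b : meet ms a b -> meet ms b a.
Proof. by case=> t [? ?]; exists t; rewrite e_sym. Qed.

(** * Exchanging the ends of short paths *)

Definition is_link (p : seq T) : bool :=
  [&& 1 < size p <= 4, uniq p & sorted e p].

Definition transp (a b v : T) : T :=
  if v == a then b else if v == b then a else v.

(** On three or four vertices, rounds 0 and 2 are equal and conjugate the middle swap [transp b c]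
    into the transposition of the two ends. Round 0 already puts the two end agents on adjacent
    vertices. *)
Definition link_round (j : nat) (p : seq T) : T -> T :=
  match p, j with
  | [:: a; b], 0 => transp a b
  | [:: a; b; c], 1 => transp b c
  | [:: a; b; c], _ => transp a b
  | [:: a; b; c; d], 1 => transp b c
  | [:: a; b; c; d], _ => transp a b \o transp c d
  | _, _ => id
  end.

Variable x0 : T.

Definition ends (p : seq T) : seq T := [:: head x0 p; last x0 p].

Variant link_spec : seq T -> Prop :=
| Link2 a b of e a b & a != b : link_spec [:: a; b]
| Link3 a b c of e a b & e b c & a != b & a != c & b != c :
    link_spec [:: a; b; c]
| Link4 a b c d of e a b & e b c & e c d & a != b & a != c & a != d
    & b != c & b != d & c != d : link_spec [:: a; b; c; d].

Lemma linkP p : is_link p -> link_spec p.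
Proof.
case/and3P; case: p => [|a [|b [|c [|d [|? ?]]]]] //= _;
  rewrite !inE ?negb_or ?andbT.
- by move=> *; constructor.
- by move=> /andP[/andP[? ?] ?] /andP[? ?]; constructor.
- by move=> /and3P[/and3P[? ? ?] /andP[? ?] ?] /and3P[? ? ?]; constructor.
Qed.

Ltac transp_compute := rewrite /= /transp ?eqxx /=;
  repeat match goal with H : is_true (?x != ?y) |- _ =>
    progress (rewrite ?(negbTE H) ?[y == x]eq_sym ?(negbTE H) ?eqxx /=) end.

Lemma link_round_mem j p v : is_link p -> v \in p ->
  [/\ link_round j p v \in p,
      link_round j p (link_round j p v) = v &
      link_round j p v = v \/ e v (link_round j p v)].
Proof.
case/linkP => [a b ab nab|a b c ab bc nab nac nbc
  |a b c d ab bc cd nab nac nad nbc nbd ncd]; case: j => [|[|j]];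
  rewrite !inE => vp; repeat (case/orP: vp => vp); move/eqP: vp => ->;
  do 2! transp_compute; split; rewrite ?orbT //; auto; right; by rewrite e_sym.
Qed.

Lemma link_rounds p v : is_link p -> v \in p ->
  link_round 2 p (link_round 1 p (link_round 0 p v)) =
  transp (head x0 p) (last x0 p) v.
Proof.
case/linkP => [a b ab nab|a b c ab bc nab nac nbc
  |a b c d ab bc cd nab nac nad nbc nbd ncd];
  rewrite !inE => vp; repeat (case/orP: vp => vp); move/eqP: vp => ->;
  do 4! transp_compute; done.
Qed.

Lemma link_round0_ends p : is_link p ->
  e (link_round 0 p (head x0 p)) (link_round 0 p (last x0 p)).
Proof.
case/linkP => [a b ab nab|a b c ab bc nab nac nbc
  |a b c d ab bc cd nab nac nad nbc nbd ncd];
  do 4! transp_compute; by rewrite // e_sym.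
Qed.

Fixpoint family_round (j : nat) (l : seq (seq T)) (v : T) : T :=
  if l is p :: l' then
    if v \in p then link_round j p v else family_round j l' v
  else v.

Lemma family_round_mem j l p v : uniq (flatten l) -> p \in l -> v \in p ->
  family_round j l v = link_round j p v.
Proof.
elim: l => //= q l IH; rewrite cat_uniq => /and3P[_ /hasPn ql ul].
rewrite inE => /orP[/eqP <- -> //|pl vp].
have /ql/negbTE : v \in flatten l by apply/flattenP; exists p.
by rewrite /= => ->; apply: IH.
Qed.

Lemma family_round_notin j l v : v \notin flatten l -> family_round j l v = v.
Proof.
by elim: l => //= q l IH; rewrite mem_cat negb_or => /andP[/negbTE -> /IH].
Qed.

Lemma family_round_matching j l : all is_link l -> uniq (flatten l) ->
  is_matching e (family_round j l).
Proof.
move=> /allP lk ul v; case: (boolP (v \in flatten l)) => [|vl].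
  case/flattenP => p pl vp; have [mp inv adj] := link_round_mem j (lk p pl) vp.
  by rewrite !(family_round_mem j ul pl).
by rewrite !family_round_notin //; split=> //; left.
Qed.

(** Inner vertices of a link may move in between, but only ends of links change occupant overall.
    Hence links sharing inner vertices can be treated one after another. *)
Definition exchanges (ms : seq (T -> T)) (l : seq (seq T)) : Prop :=
  [/\ all_matchings ms,
      forall p, p \in l -> [/\ final ms (head x0 p) = last x0 p,
        final ms (last x0 p) = head x0 p & meet ms (head x0 p) (last x0 p)] &
      forall v, v \notin flatten (map ends l) -> final ms v = v].

Lemma link_ends_mem p : is_link p -> head x0 p \in p /\ last x0 p \in p.
Proof.
by case/linkP => *; rewrite /= !inE !eqxx ?orbT.
Qed.

Lemma disjoint_exchange l : all is_link l -> uniq (flatten l) ->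
  exchanges [:: family_round 0 l; family_round 1 l; family_round 2 l] l.
Proof.
move=> lk ul; set ms := [:: _; _; _].
have fin p v : p \in l -> v \in p ->
    final ms v = transp (head x0 p) (last x0 p) v.
  move=> pl vp; have lp := allP lk _ pl.
  have [m0 _ _] := link_round_mem 0 lp vp.
  have [m1 _ _] := link_round_mem 1 lp m0.
  by rewrite /final /= !(family_round_mem _ ul pl) ?link_rounds.
split=> [[|[|[|i]]] // _|p pl|v nv]; try exact: family_round_matching.
- have lp := allP lk _ pl; have [hp tp] := link_ends_mem lp.
  rewrite !(fin p) // /transp !eqxx; split=> //.
    by case: eqP => // ->.
  exists 1; split=> //=; rewrite !(family_round_mem _ ul pl) //.
  exact: link_round0_ends.
- case: (boolP (v \in flatten l)) => [/flattenP[p pl vp]|vl]; last first.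
    by rewrite /final /= !family_round_notin.
  have ne w : w \in ends p -> v != w.
    move=> wp; apply: contraNneq nv => ->.
    by apply/flattenP; exists (ends p) => //; apply: map_f.
  by rewrite (fin p) // /transp !(negbTE (ne _ _)) // !inE eqxx ?orbT.
Qed.

(** * Splitting a family of links into disjoint subfamilies *)

Definition conflict (p q : seq T) : bool := has (mem p) q.

(** Greedy choice: a path joins [l1] unless it meets a path already chosen. *)
Lemma maximal_disjoint_subfamily l : all uniq l -> exists l1 l2,
  [/\ perm_eq l (l1 ++ l2), uniq (flatten l1) &
      forall p, p \in l2 -> has (conflict p) l1].
Proof.
elim: l => [|p l IH] /=; first by exists [::], [::].
case/andP=> up /IH[l1 [l2 [pl u1 h2]]].
case: (boolP (has (conflict p) l1)) => hp.
  exists l1, (p :: l2); split=> //.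
    by rewrite perm_sym perm_catC /= perm_cons perm_catC perm_sym.
  by move=> q; rewrite inE => /orP[/eqP -> //|/h2].
exists (p :: l1), l2; split; first by rewrite /= perm_cons.
  rewrite /= cat_uniq up u1 andbT.
  apply: contra hp => /hasP[x /flattenP[q ql xq] xp].
  by apply/hasP; exists q => //; apply/hasP; exists x.
by move=> q /h2; rewrite /= orbC => ->.
Qed.

(* Every link left out of a maximal disjoint subfamily meets one of its members,
   so removing the subfamily lowers all the conflict counts. *)
Lemma exchange_links D l : all is_link l -> uniq (flatten (map ends l)) ->
  (forall p, p \in l -> count (conflict p) l <= D) ->
  exists ms, size ms <= 3 * D /\ exchanges ms l.
Proof.
elim: D l => [|D IH] l lk ue cD.
  (* A link conflicts with itself, so the bound 0 forces [l] to be empty. *)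
  exists [::]; split=> //; case: l lk ue cD => [|p l]; first by split.
  move=> /andP[/link_ends_mem[hp _] _] _ /(_ p (mem_head _ _)) /=.
  suff -> : conflict p p by [].
  by apply/hasP; exists (head x0 p).
have [|l1 [l2 [pl u1 h2]]] := @maximal_disjoint_subfamily l.
  by apply: sub_all lk => p /and3P[].
move: lk; rewrite (perm_all _ pl) all_cat => /andP[lk1 lk2].
move: ue; rewrite (perm_uniq (perm_flatten (perm_map ends pl))) map_cat flatten_cat.
rewrite cat_uniq => /and3P[ue1 /hasPn d12 ue2].
have [|ms2 [sz2 [am2 ex2 fx2]]] := IH l2 lk2 ue2.
  move=> p pl2; have := cD p; rewrite (perm_mem pl) (permP pl) mem_cat pl2 orbT.
  move/(_ isT); rewrite count_cat; have := h2 p pl2; rewrite has_count.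
  by case: (count _ l1) => // c _; rewrite addSn ltnS; apply/leq_trans/leq_addl.
have [am1 ex1 fx1] := disjoint_exchange lk1 u1.
set ms1 := [:: _; _; _] in am1 ex1 fx1.
(* No vertex is an end both in [l1] and in [l2], so [ms1] fixes the ends in [l2] and [ms2] those in
   [l1]. *)
have mem_ends l' p v : p \in l' -> v \in ends p -> v \in flatten (map ends l').
  by move=> pl' vp; apply/flattenP; exists (ends p) => //; apply: map_f.
have hd p : head x0 p \in ends p by rewrite inE eqxx.
have tl p : last x0 p \in ends p by rewrite !inE eqxx orbT.
exists (ms1 ++ ms2); split; first by rewrite size_cat /=; lia.
split; first exact: all_matchings_cat.
- move=> p; rewrite (perm_mem pl) mem_cat !final_cat => /orP[pl1|pl2].
    have [f1 f2 m] := ex1 p pl1.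
    rewrite f1 f2 !fx2; first by split=> //; apply: meet_catl.
      by apply: (contraL (d12 _)); apply: mem_ends pl1 _.
    by apply: (contraL (d12 _)); apply: mem_ends pl1 _.
  have [f1 f2 m] := ex2 p pl2.
  have n1 v : v \in ends p -> final ms1 v = v.
    by move=> vp; apply: fx1; apply: d12; apply: mem_ends pl2 vp.
  by rewrite !n1 //; split=> //; apply: meet_catr; rewrite !n1.
- move=> v; rewrite (perm_mem (perm_flatten (perm_map ends pl))).
  rewrite map_cat flatten_cat mem_cat negb_or => /andP[v1 v2].
  by rewrite final_cat fx1 // fx2.
Qed.

(** Besides [p] itself, at most [k] members pass through each of its at most four vertices. *)
Lemma conflict_bound k l p : is_link p -> p \in l ->
  (forall v, count (fun q => v \in q) l <= k.+1) ->
  count (conflict p) l <= (4 * k).+1.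
Proof.
move=> lp pl ld; have pr := perm_to_rem pl.
have cr v : v \in p -> count (fun q => v \in q) (rem p l) <= k.
  by move=> vp; have := ld v; rewrite (permP pr) /= vp add1n ltnS.
rewrite (permP pr) /= -add1n leq_add ?leq_b1 //.
apply: (@leq_trans (\sum_(v <- p) count (fun q => v \in q) (rem p l))).
  elim: (rem p l) => [|q l' IH] /=; first by rewrite big1.
  rewrite big_split /= leq_add // /conflict.
  case: (boolP (has (mem p) q)) => //= /hasP[x xq xp].
  by rewrite (big_rem x xp) /= xq.
apply: (@leq_trans (\sum_(v <- p) k)).
  rewrite big_seq [leqRHS]big_seq; apply: leq_sum => v; exact: cr.
rewrite big_const_seq count_predT iter_addn_0 mulnC leq_mul2r.
by case/and3P: lp => /andP[_ ->]; rewrite orbT.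
Qed.

(** * Spanning trees *)

(* [Join A B] hangs the tree [B] below the root of [A] as a new child. *)
Inductive edge_tree : Type := Leaf of T | Join of edge_tree & edge_tree.
Implicit Types A B t : edge_tree.

(** * Tours of a tree and the links along them *)

Fixpoint root t : T :=
  match t with Leaf x => x | Join A _ => root A end.

(** Tours start at the root. Reversing the tour of [B] makes the whole tour end at [root B], next to
    its start [root A]. *)
Fixpoint tour t : seq T :=
  match t with Leaf x => [:: x] | Join A B => tour A ++ rev (tour B) end.

(* The two ends of the tour, which are adjacent. *)
Definition stub t : seq T :=
  match t with Leaf x => [:: x] | Join A B => [:: root A; root B] end.

(** The new link goes from the last vertex of the tour of [A] through [root A] and [root B] to the
    last vertex of the tour of [B]; each stub contributes one or two vertices. *)
Fixpoint links t : seq (seq T) :=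
  match t with
  | Leaf _ => [::]
  | Join A B =>
      links A ++ (rev (stub A) ++ stub B) :: rev (map rev (links B))
  end.

Fixpoint tree_in_graph t : bool :=
  match t with
  | Leaf _ => true
  | Join A B => [&& tree_in_graph A, tree_in_graph B & e (root A) (root B)]
  end.

Lemma root_tour t : root t \in tour t.
Proof. by elim: t => [x|A IH B _] /=; rewrite ?inE // mem_cat IH. Qed.

Lemma head_tour t : head x0 (tour t) = root t.
Proof. by elim: t => //= A <- B _; have := root_tour A; case: (tour A). Qed.

Lemma root_stub t : root t \in stub t.
Proof. by case: t => [x|A B]; rewrite /= inE eqxx. Qed.

Lemma last_rev p : last x0 (rev p) = head x0 p.
Proof. by case: p => //= a p; rewrite rev_cons last_rcons. Qed.

Lemma head_rev p : head x0 (rev p) = last x0 p.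
Proof. by rewrite -last_rev revK. Qed.

Lemma last_tour t : last x0 (tour t) = last x0 (stub t).
Proof.
case: t => //= A B; have := root_tour B; rewrite last_cat -(head_tour B).
by case: (tour B) => //= b s _; rewrite rev_cons last_rcons.
Qed.

Lemma stub_sub t : {subset stub t <= tour t}.
Proof.
case: t => [x|A B] v //=; rewrite mem_cat mem_rev 2!inE.
by case/orP=> /eqP ->; rewrite root_tour ?orbT.
Qed.

Lemma last_stub_cat p t : last x0 (p ++ stub t) = last x0 (stub t).
Proof. by rewrite last_cat; case: t. Qed.

Lemma head_stub_cat p t :
  head x0 (rev (stub t) ++ p) = last x0 (stub t).
Proof. by case: t. Qed.

(** The two equations are proved together because reversing the tour of [B] exchanges their
    roles. *)
Lemma links_ends t :
  head x0 (tour t) :: map (last x0) (links t) = tour t /\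
  rcons (map (head x0) (links t)) (last x0 (tour t)) = tour t.
Proof.
rewrite head_tour last_tour; elim: t => // A [IHA1 IHA2] B [IHB1 IHB2].
split=> /=.
  rewrite map_cat /= last_stub_cat -cat_cons IHA1 map_rev -map_comp.
  by rewrite -[in RHS]IHB2 rev_rcons
    (eq_map (g := head x0)) // => p /=; rewrite last_rev.
rewrite map_cat /= head_stub_cat -cat_rcons IHA2 rcons_cat map_rev -map_comp.
by rewrite -[in RHS]IHB1 rev_cons
  (eq_map (g := last x0)) // => p /=; rewrite head_rev.
Qed.

Lemma sorted_rev p : sorted e (rev p) = sorted e p.
Proof. by rewrite rev_sorted; apply: eq_sorted => x y; rewrite e_sym. Qed.

Lemma is_link_rev p : is_link (rev p) = is_link p.
Proof. by rewrite /is_link size_rev rev_uniq sorted_rev. Qed.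

Lemma stub_uniq t : uniq (tour t) -> uniq (stub t).
Proof.
case: t => //= A B; rewrite cat_uniq inE andbT => /and3P[_ /hasPn d _].
by apply: (contraTneq _ (root_tour A)) => ->; apply: d; rewrite mem_rev root_tour.
Qed.

Lemma links_valid t : tree_in_graph t -> uniq (tour t) ->
  all is_link (links t).
Proof.
elim: t => //= A IHA B IHB /and3P[gA gB eAB] u.
move: (u); rewrite cat_uniq rev_uniq => /and3P[uA /hasPn d uB].
rewrite all_cat IHA //= all_rev all_map (eq_all (a2 := is_link)); last first.
  exact: is_link_rev.
rewrite IHB // andbT /is_link cat_uniq rev_uniq !stub_uniq //=.
rewrite size_cat size_rev; apply/and3P; split.
- by case: (A) (B) => [?|? ?] [?|? ?].
- rewrite andbT; apply/hasPn => v /stub_sub vB; rewrite /= mem_rev.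
  by apply: (contra (@stub_sub A v)); apply: d; rewrite mem_rev.
- case: (A) (B) gA gB eAB => [a|A1 A2] [b|B1 B2] /=.
  + by move=> _ _ ->.
  + by move=> _ /and3P[_ _ ->] ->.
  + by rewrite (e_sym (root A2)) => /and3P[_ _ ->] _ ->.
  + by rewrite (e_sym (root A2)) => /and3P[_ _ ->] /and3P[_ _ ->] ->.
Qed.

Lemma links_sub t p v : p \in links t -> v \in p -> v \in tour t.
Proof.
elim: t p => //= A IHA B IHB p; rewrite !mem_cat inE mem_rev mem_rev.
case/or3P=> [/IHA h /h -> //|/eqP ->|/mapP[q qB ->]].
  rewrite mem_cat mem_rev => /orP[/stub_sub -> //|/stub_sub ->].
  by rewrite orbT.
by rewrite mem_rev => /(IHB _ qB) ->; rewrite orbT.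
Qed.

(** * The number of links through a vertex *)

Definition load t v := count (fun p => v \in p) (links t).

Lemma load_notin t v : v \notin tour t -> load t v = 0.
Proof.
move=> nv; apply/eqP; rewrite -leqn0 leqNgt -has_count; apply/hasPn => p pl.
by apply: contra nv; apply: links_sub.
Qed.

Lemma load_Join A B v :
  load (Join A B) v = load A v + ((v \in stub A) || (v \in stub B)) + load B v.
Proof.
rewrite /load /= count_cat /= mem_cat mem_rev addnA; congr (_ + _).
rewrite count_rev count_map; apply: eq_count => p /=; exact: mem_rev.
Qed.

(* The ends of the tour carry one link less, which pays for the link added there
   by [Join]. *)
Lemma load_bound t v : tree_in_graph t -> uniq (tour t) ->
  load t v <= count (e v) (tour t) + (v \notin stub t).
Proof.
elim: t => //= A IHA B IHB /and3P[gA gB eAB].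
rewrite cat_uniq rev_uniq => /and3P[uA /hasPn d uB].
rewrite load_Join count_cat count_rev.
have dAB w : w \in tour A -> w \in tour B -> False.
  by move=> wA wB; have := d w; rewrite mem_rev wB /= wA => /(_ isT).
(* The two roots get the new link and are ends of the new tour; the edge between them gives each a
   further neighbour to pay for it. *)
have nbA : v = root A -> 0 < count (e v) (tour B).
  by move=> ->; rewrite -has_count; apply/hasP; exists (root B); rewrite ?root_tour.
have nbB : v = root B -> 0 < count (e v) (tour A).
  by move=> ->; rewrite -has_count; apply/hasP; exists (root A);
    rewrite ?root_tour // e_sym.
have := IHA gA uA; have := IHB gB uB; rewrite !inE negb_or.
case: (boolP (v \in tour A)) => vA.
  have nB : v \notin tour B by apply/negP => /(dAB _ vA).
  rewrite (load_notin nB) (negbTE (contra (@stub_sub B v) nB)) orbF.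
  have -> /= : v != root B by apply: contraNneq nB => ->; apply: root_tour.
  case: eqP => [vr|_] _; last by case: (v \in stub A) => /=; lia.
  by have := nbA vr; rewrite vr root_stub /=; lia.
rewrite (load_notin vA) (negbTE (contra (@stub_sub A v) vA)) /=.
have -> /= : v != root A by apply: contraNneq vA => ->; apply: root_tour.
case: eqP => [vr|_]; last by case: (v \in stub B) => /=; lia.
by have := nbB vr; rewrite vr root_stub /=; lia.
Qed.

(** Each vertex of the tour is a leaf of the term, where [y] can be hung. Keeping the root keeps the
    edges of the enclosing [Join]s. *)
Lemma tree_insert t x y : tree_in_graph t -> x \in tour t -> e x y ->
  exists t', [/\ tree_in_graph t', root t' = root t &
                 perm_eq (tour t') (y :: tour t)].
Proof.
elim: t => [z _|A IHA B IHB /= /and3P[gA gB eAB]].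
  rewrite inE => /eqP <- exy; exists (Join (Leaf x) (Leaf y)); split=> //=.
  by rewrite (perm_catC [:: x] [:: y]).
rewrite mem_cat mem_rev => /orP[xA|xB] exy.
  have [A' [gA' rA' pA']] := IHA gA xA exy.
  exists (Join A' B); split=> //=; first by rewrite gA' gB rA'.
  by rewrite -cat_cons perm_cat2r.
have [B' [gB' rB' pB']] := IHB gB xB exy.
exists (Join A B'); split=> //=; first by rewrite gA gB' rB'.
rewrite perm_sym -cat1s perm_catCA perm_cat2l perm_sym perm_rev.
by rewrite (perm_trans pB') // perm_cons perm_sym perm_rev.
Qed.

Lemma spanning_tree : connected_graph e -> exists t,
  [/\ tree_in_graph t, uniq (tour t) & forall v, v \in tour t].
Proof.
move=> conn.
suff grow m : m < #|T| -> exists t,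
    [/\ tree_in_graph t, uniq (tour t) & size (tour t) = m.+1].
  have [|t [gt ut st]] := grow #|T|.-1.
    by rewrite ltn_predL; apply/card_gt0P; exists x0.
  exists t; split=> // v; have c : #|tour t| = #|T|.
    by rewrite (card_uniqP ut) st prednK //; apply/card_gt0P; exists x0.
  have /subset_cardP : #|tour t| = #|predT : pred T| by rewrite c.
  by move/(_ (subset_predT _))/(_ v) ->.
elim: m => [_|m IH ltm]; first by exists (Leaf x0).
have [t [gt ut st]] := IH (ltnW ltm).
have [y yt] : exists y, y \notin tour t.
  apply/existsP; rewrite -negb_forall; apply/forallP => all_t.
  have : #|T| <= #|tour t| by apply: subset_leq_card; apply/subsetP=> v _.
  by rewrite (card_uniqP ut) st leqNgt ltm.
(* A path from the root to the missing vertex [y] leaves the tree along some edge. *)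
have [x [z [xt zt exz]]] : exists x z, [/\ x \in tour t, z \notin tour t & e x z].
  have /connectP[p] := conn (root t) y.
  elim: p (root t) (root_tour t) => [|z p IHp] x xt /=.
    by move=> _ yx; rewrite yx xt in yt.
  case/andP=> exz pz ly; case: (boolP (z \in tour t)) => zt; first exact: IHp ly.
  by exists x, z.
have [t' [gt' _ pt']] := tree_insert gt xt exz.
exists t'; split=> //; last by rewrite (perm_size pt') /= st.
by rewrite (perm_uniq pt') /= zt.
Qed.

(** * Odd-even transposition along a chain of links *)

Lemma flatten_pairs (b m : nat) :
  flatten [seq [:: b + i.*2; (b + i.*2).+1] | i <- iota 0 m] = iota b m.*2.
Proof.
elim: m => // m IH; rewrite -addn1 iotaD map_cat flatten_cat IH /= add0n.
by rewrite addn1 doubleS -addn2 iotaD.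
Qed.

Section Chain.

Variables (s : seq T) (L : seq (seq T)) (k : nat).
Hypotheses (s_uniq : uniq s) (L_link : all is_link L).
Hypotheses (L_head : rcons (map (head x0) L) (last x0 s) = s)
  (L_last : head x0 s :: map (last x0) L = s).
Hypothesis L_load : forall v, count (fun q => v \in q) L <= k.+1.

Let n := size s.
Let sv := nth x0 s.

Lemma chain_size : n = (size L).+1.
Proof. by rewrite /n -L_last /= size_map. Qed.

Lemma chain_head i : i.+1 < n -> head x0 (nth [::] L i) = sv i.
Proof.
rewrite chain_size ltnS => lti.
by rewrite /sv -L_head nth_rcons size_map lti (nth_map [::]).
Qed.

Lemma chain_last i : i.+1 < n -> last x0 (nth [::] L i) = sv i.+1.
Proof.
rewrite chain_size ltnS => lti.
by rewrite /sv -L_last /= (nth_map [::]).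
Qed.

(** The links starting at indices of the parity of [t] have pairwise distinct ends, so they can be
    exchanged together. *)
Lemma odd_even_round (t : nat) : exists ms, size ms <= 3 * (4 * k).+1 /\
  [/\ all_matchings ms,
      forall j, j.+1 < n -> odd j = odd t ->
        [/\ final ms (sv j) = sv j.+1, final ms (sv j.+1) = sv j &
            meet ms (sv j) (sv j.+1)] &
      forall j, j < n -> (if odd j == odd t then j.+1 == n else j == 0) ->
        final ms (sv j) = sv j].
Proof.
(* The first pair starts at index [b], and [m] pairs fit; index 0 is unpaired when [b] is 1, and the
   last index when [n - b] is odd. *)
pose b : nat := odd t; pose m := (n - b)./2.
pose idx := [seq b + i.*2 | i <- iota 0 m].
have idxP j : (j \in idx) = (j.+1 < n) && (odd j == odd t).
  apply/mapP/andP => [[i]|[ltj /eqP oj]].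
    rewrite mem_iota /m => /andP[_ lti] ->; split; first by lia.
    by rewrite oddD odd_double addbF /b oddb.
  exists (j - b)./2; last by rewrite /b; lia.
  by rewrite mem_iota /m /b; lia.
pose l := map (nth [::] L) idx.
have idxL j : j \in idx -> j < size L.
  by rewrite idxP chain_size => /andP[].
have lL : {subset l <= L} by move=> p /mapP[j /idxL jL ->]; apply: mem_nth.
have ends_l : flatten (map ends l) = map sv (iota b m.*2).
  rewrite -flatten_pairs map_flatten -!map_comp; congr flatten.
  apply/eq_in_map => i im /=.
  have : b + i.*2 \in idx by apply: map_f.
  by rewrite idxP => /andP[lt _]; rewrite /ends chain_head ?chain_last.
have uidx : uniq idx.
  by rewrite map_inj_uniq ?iota_uniq // => i j; lia.
have ld v : count (fun q => v \in q) l <= k.+1.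
  apply: leq_trans (L_load v); rewrite -[in leqRHS](mkseq_nth [::] L)
    [leqLHS]count_map [leqRHS]count_map.
  rewrite -!size_filter; apply: uniq_leq_size; first exact: filter_uniq.
  by move=> j; rewrite !mem_filter mem_iota => /andP[-> /idxL].
have lk : all is_link l by apply/allP => p /lL; apply: allP.
have [||ms [sz [am ex fx]]] := @exchange_links (4 * k).+1 l lk.
- rewrite ends_l map_inj_in_uniq ?iota_uniq // => i j.
  rewrite !mem_iota /m => lti ltj /eqP; rewrite nth_uniq //; [by move/eqP| |];
    rewrite -/n; lia.
- by move=> p pl; apply: conflict_bound => //; apply: allP pl.
exists ms; split=> //; split=> // [j ltj oj|j ltj hj].
  have jl : nth [::] L j \in l by apply: map_f; rewrite idxP ltj oj eqxx.
  by have := ex _ jl; rewrite chain_head ?chain_last.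
apply: fx; rewrite ends_l; apply/mapP => -[i]; rewrite mem_iota /m => lti /eqP.
rewrite nth_uniq //; last by rewrite -/n; lia.
move/eqP=> ji; move: hj lti; rewrite -{}ji /b; case: ifP => oj /eqP; lia.
Qed.

(* Agents travel around a cycle of length [2 * n] folded onto the chain: code
   [c < n] is the vertex of index [c] about to move right, and code [c >= n] the
   vertex of index [2 * n - 1 - c] about to move left. *)
Definition folded (c : nat) : T := sv (if c < n then c else (n.*2 - c).-1).

(** Starting from even codes, the code before round [t] has the parity of [t], so each round
    advances it by one. Codes with sum [2 * n - 2], the smaller below [n - 1], face each other on
    consecutive vertices. *)
Lemma odd_even_rounds (t : nat) : exists ms, size ms <= t * (3 * (4 * k).+1) /\
  [/\ all_matchings ms,
      forall c, c < n.*2 -> ~~ odd c ->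
        final ms (folded c) = folded ((c + t) %% n.*2) &
      forall c d u, c < n.*2 -> d < n.*2 -> ~~ odd c -> ~~ odd d -> u < t ->
        (c + u) %% n.*2 < n.-1 -> (c + u) %% n.*2 + (d + u) %% n.*2 = n.*2 - 2 ->
        meet ms (folded c) (folded d)].
Proof.
have n_gt0 : 0 < n by rewrite chain_size.
have odd_code c u : ~~ odd c -> odd ((c + u) %% n.*2) = odd u.
  by move=> oc; rewrite odd_mod ?odd_double // oddD (negbTE oc).
elim: t => [|t [ms [sz [am fin mt]]]].
  by exists [::]; split=> //; split=> // c ltc _; rewrite addn0 modn_small.
have [ms' [sz' [am' sw fx]]] := odd_even_round t.
exists (ms ++ ms'); rewrite size_cat mulSnr leq_add //; split=> //; split.
- exact: all_matchings_cat.
- move=> c ltc oc; rewrite final_cat fin //.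
  have oct := odd_code c t oc.
  have ltw : (c + t) %% n.*2 < n.*2 by rewrite ltn_pmod ?double_gt0.
  have -> : (c + t.+1) %% n.*2 =
      if ((c + t) %% n.*2).+1 == n.*2 then 0 else ((c + t) %% n.*2).+1.
    rewrite addnS -addn1 -modnDml addn1; case: eqP => [->|/eqP ne].
      by rewrite modnn.
    by rewrite modn_small // ltn_neqAle ne.
  move: ((c + t) %% n.*2) oct ltw => w ow ltw; rewrite /folded.
  (* Codes [2 * n - 1] and [n - 1] are the turning points: the agent waits at an end of the chain
     while its code advances. *)
  case: eqP => [w1|/eqP w1].
    have -> : (if w < n then w else (n.*2 - w).-1) = 0 by case: ltnP; lia.
    by rewrite n_gt0 fx //; case: eqP => //; lia.
  have [ltwn|lewn] := ltnP w n.
    have [ltwn'|] := ltnP w.+1 n; first by have [-> _ _] := sw w ltwn' ow.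
    move=> lenw; have wn : w.+1 = n by lia.
    have -> : (n.*2 - w.+1).-1 = w by lia.
    by rewrite fx // ow eqxx; apply/eqP.
  rewrite ltnNge (leq_trans lewn) //=.
  have -> : (n.*2 - w).-1 = (n.*2 - w.+1).-1.+1 by lia.
  by have [||_ -> _] := sw (n.*2 - w.+1).-1; try lia.
- move=> c d u ltc ltd oc od; rewrite ltnS leq_eqVlt => /orP[/eqP ->|ltu] wl wd.
    apply: meet_catr; rewrite !fin // /folded.
    have -> : ((c + t) %% n.*2 < n) by lia.
    have -> : ((d + t) %% n.*2 < n) = false by lia.
    have -> : (n.*2 - (d + t) %% n.*2).-1 = ((c + t) %% n.*2).+1 by lia.
    have oct := odd_code c t oc.
    by have [||_ _] := sw ((c + t) %% n.*2); try lia.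
  by apply: meet_catl; apply: (mt c d u).
Qed.

Lemma chain_strategy : exists ms, size ms <= n * (3 * (4 * k).+1) /\
  (all_matchings ms /\ forall a b, a \in s -> b \in s -> a != b -> meet ms a b).
Proof.
have [ms [sz [am _ mt]]] := odd_even_rounds n.
exists ms; split=> //; split=> // a b sa sb ab.
have code x : x \in s -> exists c, [/\ c < n.*2, ~~ odd c & folded c = x].
  move=> sx; have lti : index x s < n by rewrite index_mem.
  have sx' : sv (index x s) = x by apply: nth_index.
  case: (boolP (odd (index x s))) => oi.
    (* An agent at an odd index starts moving left, which makes its code even. *)
    exists (n.*2 - (index x s).+1); split; try lia.
    by rewrite /folded ltnNge (_ : _ <= _) /= -?[RHS]sx' ?/sv; first congr nth; lia.
  by exists (index x s); rewrite oi /folded lti; split=> //; lia.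
have [c [ltc oc ca]] := code a sa; have [d [ltd od db]] := code b sb.
have ncd : c != d by apply: contraNneq ab => cd; rewrite -ca -db cd.
suff [u [ltu sum]] : exists u, u < n /\
    (c + u) %% n.*2 + (d + u) %% n.*2 = n.*2 - 2 /\
    (c + u) %% n.*2 != (d + u) %% n.*2.
  case: sum => sum ne; rewrite -ca -db.
  (* Two distinct codes with sum [2 * (n - 1)]: exactly one lies below [n - 1]. *)
  case: (ltnP ((c + u) %% n.*2) n.-1) => [lt|ge]; first exact: (mt c d u).
  by apply: meet_sym; apply: (mt d c u) => //; lia.
have red x : x < n.*2 -> (n.*2 + x) %% n.*2 = x.
  by move=> ltx; rewrite modnDl modn_small.
have [lt|ge] := ltnP (c + d) n.*2.
  (* This [u] solves [c + d + 2 * u = 2 * n - 2], as [c + d] is even; neither code wraps around. *)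
  by exists (n.-1 - (c + d)./2); rewrite !modn_small; lia.
(* Now [c + d + 2 * u = 4 * n - 2], and since [c != d] exactly one of the two codes wraps around. *)
exists (n.*2.-1 - (c + d)./2); split; first lia.
set u := _ - _; have [lt|le] := ltnP (c + u) n.*2.
  rewrite (modn_small lt) -(@subnKC n.*2 (d + u)) ?red; rewrite /u; lia.
rewrite -(@subnKC n.*2 (c + u)) ?red ?[(d + u) %% _]modn_small; rewrite /u; lia.
Qed.

End Chain.

End Acquaintance.

(** * The bound in terms of the maximal degree *)

Theorem theorem2p1 (T : finType) (e : rel T) :
  simple_graph e -> connected_graph e ->
  AC_le e (20 * max_degree e * #|T|).
Proof.
move=> [e_sym _] conn.
have [le1|gt1] := leqP #|T| 1.
  exists [::]; split=> //; split=> // a b ab.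
  by have := fintype_le1P le1 a b => eab; rewrite eab eqxx in ab.
have /card_gt0P[x0 _] : 0 < #|T| by apply: ltnW.
have [t [gt ut tT]] := spanning_tree x0 conn.
have deg v : count (e v) (tour t) <= max_degree e.
  rewrite -size_filter -(card_uniqP (filter_uniq _ ut)).
  apply: leq_trans (leq_bigmax v); apply: subset_leq_card; apply/subsetP => u.
  by rewrite mem_filter inE => /andP[].
have [hl hh] := links_ends x0 t.
have [|ms [sz [am mt]]] :=
    chain_strategy (k := max_degree e) e_sym ut (links_valid e_sym gt ut) hh hl.
  move=> v; rewrite -addn1; apply: leq_trans (load_bound e_sym v gt ut) _.
  by rewrite leq_add ?leq_b1.
exists ms; split; first by split=> // a b ab; apply: mt.
have sT : size (tour t) = #|T|.
  by rewrite -(card_uniqP ut); apply: eq_card.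
(* A positive degree absorbs the additive constant in [3 * (4 * max_degree e + 1)]; this is why the
   one-vertex graph was treated apart. *)
have D_gt0 : 0 < max_degree e.
  have [a [b [_ _ ab]]] := card_gt1P gt1.
  have /connectP[[|z p] /= path_ab b_last] := conn a b.
    by rewrite b_last eqxx in ab.
  apply: leq_trans (leq_bigmax a); apply/card_gt0P; exists z.
  by rewrite inE; case/andP: path_ab.
apply: leq_trans sz _; rewrite sT mulnC leq_mul2r; apply/orP; right; lia.
Qed.
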